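(* Let $I=[0,1]$ with Lebesgue measure $m$, let $S$ be the one-sided shift on $(I^{\infty},m^{\infty})$, let $\mathfrak{M}=\{\{t_n\}_{n\ge1}: t_n\in\{1,\dots,n\}\}$ with measure $\mu=\prod_n\mu_n$ ($\mu_n$ uniform on $\{1,\dots,n\}$), and let $J:I^{\infty}\to\mathfrak{M}$ be given (on sequences with pairwise distinct coordinates) by $J(\{x_n\})_n=\#\{i\le n: x_i\le x_n\}$; $J$ is a mod $0$ measure-preserving isomorphism. For $t\in\mathfrak{M}$ define marked positions inductively: position $1$ is marked; if $d_n(t)$ denotes the number of marked positions among $1,\dots,n$, then position $n+1$ is marked iff $t_{n+1}\le d_n(t)$. Then the map $\Lambda=JSJ^{-1}:\mathfrak{M}\to\mathfrak{M}$ is given, for $\mu$-almost every $t$, by $\Lambda(\{t_n\})=\{t'_n\}$ with $$t'_n=\begin{cases}t_{n+1}&\text{if position }n+1\text{ is marked},\\ t_{n+1}-1&\text{if position }n+1\text{ is not marked.}\end{cases}$$ *)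

(* Defs.v *)
From HB Require Import structures.
From mathcomp Require Import all_boot all_order all_algebra.
From mathcomp Require Import all_classical all_reals all_analysis.

Set Implicit Arguments.
Unset Strict Implicit.
Unset Printing Implicit Defensive.

Import Order.TTheory GRing.Theory Num.Theory.

Local Open Scope classical_set_scope.
Local Open Scope ring_scope.

(** Sequences are indexed from 0: the term of index [n] of a Rocq sequence is
    the term of index [n + 1] of the mathematical one.  The values of the
    sequences in [rank_seq] are not shifted. *)

Section product_space.
Context {Omega : Type} {d : measure_display} {T : measurableType d}.
Variable c : nat -> Omega -> T.

(** Generators of the product sigma-algebra, [c] being the coordinate maps. *)
Definition coord_sets : set (set Omega) :=
  [set C | exists n B, measurable B /\ C = c n @^-1` B].

(** [P] is the product of the laws [nu 0], [nu 1], and so on: this determines a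
    probability measure on the sigma-algebra generated by [coord_sets]. *)
Definition is_product_measure {R : realType} (nu : nat -> set T -> \bar R)
    (P : set Omega -> \bar R) : Prop :=
  forall (n : nat) (B : nat -> set T), (forall i, measurable (B i)) ->
    P (\bigcap_(i in `I_n) c i @^-1` B i) = (\prod_(i < n) nu i (B i))%E.

End product_space.

(** [f : X -> Y] is a measure-preserving isomorphism mod 0, with inverse mod 0
    [g]. *)
Definition mod0_isomorphism {R : realType} {d1 d2 : measure_display}
    {X : measurableType d1} {Y : measurableType d2}
    (P : probability X R) (Q : probability Y R) (f : X -> Y) (g : Y -> X)
    : Prop :=
  exists (A : set X) (B : set Y),
    [/\ measurable A, measurable B, P A = 1%E & Q B = 1%E] /\
    [/\ set_fun A B f, set_fun B A g,
        {in A, cancel f g} & {in B, cancel g f}] /\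
    [/\ measurable_fun A f, measurable_fun B g &
        forall C, measurable C -> P (A `&` f @^-1` C) = Q C].

Section cube.
Variable R : realType.

Definition cube_coord (n : nat) (x : nat -> {i01 R}) : R := (x n)%:num.

HB.instance Definition _ := isPointed.Build {i01 R} 0%:i01.

(** The space of sequences in [0, 1], with the product sigma-algebra. *)
Definition cube : Type := g_sigma_algebraType (coord_sets cube_coord).

HB.instance Definition _ := Measurable.copy cube
  (g_sigma_algebraType (coord_sets cube_coord)).

(** Lebesgue measure on [0, 1], as a measure on [R]. *)
Definition lebesgue01 (B : set R) : \bar R :=
  lebesgue_measure (B `&` `[0, 1]).

Definition is_cube_measure (P : probability cube R) : Prop :=
  is_product_measure cube_coord (fun=> lebesgue01) P.

Definition shift (x : cube) : cube := fun n => x n.+1.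

End cube.

Record rank_seq_base := RankSeq {
  entry :> nat -> nat;
  entryP : forall n, (1 <= entry n <= n.+1)%N }.

Definition rank_coord (n : nat) (t : rank_seq_base) : nat := t n.

Lemma ones_subproof n : (1 <= (fun=> 1%N) n <= n.+1)%N.
Proof. by []. Qed.

HB.instance Definition _ := gen_eqMixin rank_seq_base.
HB.instance Definition _ := gen_choiceMixin rank_seq_base.
HB.instance Definition _ := isPointed.Build rank_seq_base (RankSeq ones_subproof).

(** The space of sequences [t] with [t n] in [{1, ..., n + 1}], with the product
    of the discrete sigma-algebras. *)
Definition rank_seq : Type := g_sigma_algebraType (coord_sets rank_coord).

HB.instance Definition _ := Measurable.copy rank_seq
  (g_sigma_algebraType (coord_sets rank_coord)).

(** The uniform law on [{1, ..., n + 1}], as a measure on [nat]. *)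
Definition uniform_rank {R : realType} (n : nat) (B : set nat) : \bar R :=
  ((n.+1%:R^-1)%:E * \sum_(1 <= k < n.+2) \d_k B)%E.

Definition is_rank_measure {R : realType} (mu : probability rank_seq R)
    : Prop :=
  is_product_measure rank_coord uniform_rank mu.

Section ranks.
Variable R : realType.

Definition rank_of (x : cube R) (n : nat) : nat :=
  #|[pred i : 'I_n.+1 | (x i)%:num <= (x n)%:num]|.

Lemma rank_ofP (x : cube R) n : (1 <= rank_of x n <= n.+1)%N.
Proof.
apply/andP; split.
  by apply/card_gt0P; exists ord_max; rewrite inE.
by rewrite -[leqRHS]card_ord max_card.
Qed.

(** The same formula is used for sequences with repeated terms, which form a
    null set. *)
Definition J (x : cube R) : rank_seq := RankSeq (rank_ofP x).

(** [Jinv] stands for an inverse mod 0 of [J]. *)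
Definition Lambda (Jinv : rank_seq -> cube R) (t : rank_seq) : rank_seq :=
  J (shift (Jinv t)).

End ranks.

(** [nmarked t n] is the number of marked terms among the first [n] ones. *)
Fixpoint nmarked (t : rank_seq) (n : nat) : nat :=
  if n is m.+1 then
    (nmarked t m + ((m == 0%N) || (entry t m <= nmarked t m)%N))%N
  else 0%N.

Definition marked (t : rank_seq) (n : nat) : bool :=
  (n == 0%N) || (entry t n <= nmarked t n)%N.

Lemma nmarkedE (t : rank_seq) n : nmarked t n = (\sum_(i < n) marked t i)%N.
Proof. by elim: n => [|n IH]; rewrite ?big_ord0// big_ord_recr /= -IH. Qed.

(* Main.v *)
(** If [t = J x], then position [n > 0] is marked exactly when [x n < x 0].
    Hence deleting [x 0] lowers the rank of [x n] by one exactly when [n] is not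
    marked.  This holds for every [x], even with repeated coordinates, so the
    exceptional set is only the one where [Jinv] is not a right inverse of
    [J]. *)
Require Import Defs.
From mathcomp Require Import all_boot all_order all_algebra.
From mathcomp Require Import all_classical all_reals all_analysis.

Set Implicit Arguments.
Unset Strict Implicit.
Unset Printing Implicit Defensive.

Import Order.TTheory GRing.Theory Num.Theory.

Local Open Scope ring_scope.

Section marked_ranks.
Context {R : realType}.
Implicit Types x : cube R.

(** Index 0 is included by convention, as it is always marked although [x 0 < x 0] fails. *)
Definition below_first x (n : nat) : bool :=
  (n == 0%N) || ((x n)%:num < (x 0%N)%:num).

Lemma rank_of_sum x n :
  rank_of x n = (\sum_(i < n.+1) ((x i)%:num <= (x n)%:num)%R)%N.
Proof. by rewrite /rank_of -sum1_card big_mkcond; apply: eq_bigr. Qed.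

Lemma rank_of_shift x n :
  rank_of x n.+1 = (((x 0%N)%:num <= (x n.+1)%:num)%R + rank_of (Defs.shift x) n)%N.
Proof. by rewrite !rank_of_sum big_ord_recl. Qed.

Lemma rank_of_le_below_first x n :
  (rank_of x n.+1 <= \sum_(i < n.+1) below_first x i)%N
  = ((x n.+1)%:num < (x 0%N)%:num).
Proof.
rewrite rank_of_sum big_ord_recr /= lexx addn1.
case: ltP => [x_lt|x_ge].
  (* The rank counts [n.+1] but not 0, the other sum counts 0: these units cancel, and any
     [x i <= x n.+1] lies below [x 0]. *)
  rewrite !big_ord_recl /= leNgt x_lt add0n add1n ltnS.
  apply: leq_sum => i _; rewrite /below_first /=.
  by case: (leP _ (x n.+1)%:num) => // /le_lt_trans/(_ x_lt) ->.
(* Now each index in [below_first] is counted by the rank, which also counts [n.+1], hence is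
   strictly larger. *)
apply/negbTE; rewrite -ltnNge ltnS; apply: leq_sum => i _.
rewrite /below_first; case: eqP => [->|_] /=; first by rewrite x_ge.
by case: (ltP _ (x 0%N)%:num) => // /ltW/le_trans/(_ x_ge) ->.
Qed.

Lemma nmarked_J x n : nmarked (J x) n = (\sum_(i < n) below_first x i)%N.
Proof.
elim: n => [|n IH]; first by rewrite big_ord0.
rewrite big_ord_recr /= -IH; congr (_ + nat_of_bool _)%N.
by case: n IH => // n ->; rewrite rank_of_le_below_first.
Qed.

Lemma marked_J x n : marked (J x) n = below_first x n.
Proof.
by case: n => // n; rewrite /marked nmarked_J rank_of_le_below_first.
Qed.

Lemma J_shift x n :
  entry (J (Defs.shift x)) n =
    if marked (J x) n.+1 then entry (J x) n.+1 else (entry (J x) n.+1 - 1)%N.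
Proof.
rewrite marked_J /= rank_of_shift /below_first /=.
by case: ltP => _; rewrite ?add0n ?add1n ?subn1.
Qed.

End marked_ranks.

Theorem theorem2 (R : realType)
    (P : probability (cube R) R) (mu : probability rank_seq R)
    (P_product : is_cube_measure P) (mu_product : is_rank_measure mu)
    (Jinv : rank_seq -> cube R)
    (J_iso : mod0_isomorphism P mu (@J R) Jinv) :
  {ae mu, forall t : rank_seq, forall n : nat,
    entry (Lambda Jinv t) n =
      if marked t n.+1 then entry t n.+1 else (entry t n.+1 - 1)%N}.
Proof.
have [A [B [[_ mB _ muB] [[_ _ _ JinvK] _]]]] := J_iso.
exists (~` B)%classic; split; first exact: measurableC.
  by rewrite probability_setC// muB subee.
apply: subsetC => t Bt n /=.
(* [Lambda Jinv t] is already [J (shift (Jinv t))], so [t] becomes [J (Jinv t)] on the right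
   only. *)
by rewrite -[in RHS](JinvK t (mem_set Bt)) -J_shift.
Qed.
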